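(* Let $K\in[0,\infty)$, $\Delta\in\mathbb R$, and $q\in\{1,2\}$. The (weak) limit BCP measure $\pi^s_{K,\Delta,q}=\lim_{\Lambda\uparrow\mathbb L^d}\pi^s_{\Lambda,K,\Delta,q}$ exists, for $s=0,1,\dots,q$.
   Context: Let $d\ge2$ and let $\mathbb L^d=(\mathbb Z^d,\mathbb E^d)$ be the hypercubic lattice, where $\mathbb E^d$ is the set of unordered pairs $\langle x,y\rangle$ with $\sum_i|x_i-y_i|=1$. A box-region is a pair $\Lambda=(V,E)$ where $V=\prod_{i=1}^d[a_i,b_i]$ is a box of $\mathbb Z^d$ and $E$ is the set of all edges of $\mathbb E^d$ with at least one endvertex in $V$; $V^+$ is the set of endvertices of edges in $E$ and $\partial\Lambda=V^+\setminus V$. $\Lambda\uparrow\mathbb L^d$ means that $\Lambda$ runs along a sequence of box-regions whose vertex-sets increase to $\mathbb Z^d$. The Blume--Capel--Potts (BCP) measure with parameters $K,\Delta,q$ on a finite graph $G=(W,F)$ is the probability measure on $\{0,1,\dots,q\}^W$ given by $$\pi(\sigma)\propto\exp\Big[-K|F_\sigma|+2K\sum_{e\in F}\delta_e(\sigma)+\Delta\sum_{x\in W}\delta_{\sigma_x,0}\Big],$$ where $F_\sigma$ is the set of edges $\langle x,y\rangle\in F$ with $\sigma_x\ne0$, $\sigma_y\neq0$, and $\delta_e(\sigma)=\delta_{\sigma_x,\sigma_y}(1-\delta_{\sigma_x,0})$ for $e=\langle x,y\rangle$ ($\delta_{u,v}$ is the Kronecker delta). $\pi^s_{\Lambda,K,\Delta,q}$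 is the BCP measure on $\Lambda$ with boundary condition $s$: for $s\in\{1,\dots,q\}$ it is the marginal on $\{0,1,\dots,q\}^V$ of the BCP measure on the graph $(V^+,E)$ conditioned on $\sigma_x=s$ for all $x\in\partial\Lambda$; for $s=0$ it is the BCP measure with free boundary condition, that is, on the graph with vertex-set $V$ and edge-set those edges of $E$ having both endvertices in $V$. The limit is in the sense of weak convergence on $\{0,1,\dots,q\}^{\mathbb Z^d}$ (convergence of probabilities of cylinder events). *)

(* Defs.v *)
From HB Require Import structures.
From mathcomp Require Import all_boot all_order all_algebra finmap zify.
From mathcomp Require Import all_classical all_reals all_analysis.
Set Implicit Arguments.
Unset Strict Implicit.
Unset Printing Implicit Defensive.
Import Order.TTheory GRing.Theory Num.Theory.
Local Open Scope classical_set_scope.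
Local Open Scope ring_scope.

HB.instance Definition _ (n : nat) := isPointed.Build 'I_n.+1 ord0.

(* The graph (W, F) is a finite vertex type W with a set F of edges, an edge
   <x, y> being the two-element set of its endvertices.  The spin set
   {0, 1, ..., q} is 'I_q.+1. *)
Section FiniteGraph.
Variables (R : realType) (q : nat) (K Delta : R).
Variables (W : finType) (F : {set {set W}}).
Implicit Types (sigma : {ffun W -> 'I_q.+1}) (e : {set W}).
Implicit Types (A B : {set {ffun W -> 'I_q.+1}}).

Definition occupied_edges sigma : {set {set W}} :=
  [set e in F | [exists x, exists y,
     [&& e == [set x; y], sigma x != ord0 & sigma y != ord0]]]%SET.

Definition edge_delta sigma e : bool :=
  [exists x, exists y,
     [&& e == [set x; y]%SET, sigma x == sigma y & sigma x != ord0]].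

Definition bcp_weight sigma : R :=
  expR (- K * #|occupied_edges sigma|%:R
        + 2 * K * (\sum_(e in F) (edge_delta sigma e)%:R)
        + Delta * (\sum_(x : W) (sigma x == ord0)%:R)).

Definition bcp_prob A : R :=
  (\sum_(sigma in A) bcp_weight sigma) / (\sum_sigma bcp_weight sigma).

Definition bcp_cond_prob A B : R := bcp_prob (A :&: B)%SET / bcp_prob B.

End FiniteGraph.

Lemma int_near (m n : int) : `|m - n| <= 1 ->
  [/\ m - 1 <= n <= m + 1, n - 1 <= m <= n + 1,
      m - 1 <= m <= m + 1 & n - 1 <= n <= n + 1].
Proof. by move=> h; split; lia. Qed.

Section Lattice.
Variable d : nat.
Notation Zd := 'rV[int]_d.
Implicit Types (x y a b : Zd) (V : {fset Zd}).

Definition lattice_edge : set {fset Zd} :=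
  [set e | exists x y,
     e = [fset x; y]%fset /\ \sum_(i < d) `|x 0 i - y 0 i| = 1].

Definition in_box a b x : Prop :=
  forall i, a 0 i <= x 0 i /\ x 0 i <= b 0 i.

Definition box a b : {fset Zd} := fset_set [set x | in_box a b x].

Definition region_edge V : set {fset Zd} :=
  [set e | lattice_edge e /\ exists2 x, x \in V & x \in e].

Definition region_closure V : {fset Zd} :=
  fset_set [set x | exists2 e, region_edge V e & x \in e].

(* The members of E with both endvertices in W, as sets of elements of the
   finite type W. *)
Definition edges_on (W : {fset Zd}) (E : set {fset Zd}) : {set {set W}} :=
  [set e : {set W} | `[< E [fset val x | x in e]%fset >]]%SET.

(* [fset_set] is [fset0] on infinite sets, so the next two finiteness facts are
   what make [box] and [region_closure] the intended sets. *)
Lemma finite_in_box a b : finite_set [set x | in_box a b x].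
Proof.
pose N := (\sum_(i < d) `|(b 0 i - a 0 i)%R|)%N.+1.
pose g (k : {ffun 'I_d -> 'I_N}) : Zd := \row_i (a 0 i + (k i)%:Z).
apply: (@sub_finite_set _ _ (g @` setT)); last first.
  by apply: finite_image; exact: finite_finset.
move=> x /= hx; exists [ffun i => inord `|(x 0 i - a 0 i)%R|%N] => //.
apply/rowP => i; rewrite !mxE ffunE; have [h1 h2] := hx i.
rewrite inordK; first lia.
by rewrite ltnS (bigD1 i) //=; lia.
Qed.

Lemma finite_region_closure V :
  finite_set [set x | exists2 e, region_edge V e & x \in e].
Proof.
pose c : Zd := const_mx 1.
apply: (@sub_finite_set _ _
  (\bigcup_(v in [set` V]) [set x | in_box (v - c) (v + c) x])); last first.
  by apply: bigcup_finite => // v _; exact: finite_in_box.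
move=> x /= [e [[u [w [-> huw]]] [v vV ve]] xe]; exists v => //= i.
have : `|u 0 i - w 0 i| <= 1.
  by rewrite -huw (bigD1 i) //= lerDl sumr_ge0.
move/int_near => [/andP[? ?] /andP[? ?] /andP[? ?] /andP[? ?]].
have [ve' xe'] : (v = u \/ v = w) /\ (x = u \/ x = w).
  by move: ve xe; rewrite !inE; do 2 case/orP => /eqP ->; split; auto.
by rewrite /c !mxE; case: ve' => ->; case: xe' => ->; split.
Qed.

End Lattice.

Section BoxMeasure.
Variables (R : realType) (d q : nat) (K Delta : R) (s : 'I_q.+1).
Notation Zd := 'rV[int]_d.
Implicit Types V : {fset Zd}.

(* pi^s_Lambda({eta}) for Lambda the region with vertex-set V *)
Definition bcp_region V (eta : {ffun V -> 'I_q.+1}) : R :=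
  if s == ord0 then
    bcp_prob K Delta (edges_on V (region_edge V)) [set eta]%SET
  else
    bcp_cond_prob K Delta (edges_on (region_closure V) (region_edge V))
      [set sigma : {ffun region_closure V -> 'I_q.+1} |
         [forall x, forall y, (val x == val y) ==> (sigma x == eta y)]]%SET
      [set sigma : {ffun region_closure V -> 'I_q.+1} |
         [forall x, (val x \notin V) ==> (sigma x == s)]]%SET.

(* A configuration on V is extended to Z^d by s off V.  The choice is
   immaterial: a cylinder event depends only on spins in V once V is large. *)
Definition extend_config V (eta : {ffun V -> 'I_q.+1}) : Zd -> 'I_q.+1 :=
  fun x => if insub x is Some u then eta u else s.

Definition bcp_box (a b : Zd) (A : set (Zd -> 'I_q.+1)) : R :=
  \sum_(eta : {ffun box a b -> 'I_q.+1} | `[< A (extend_config eta) >])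
     bcp_region eta.

End BoxMeasure.

Section WeakLimit.
Variables (d q : nat).
Notation Zd := 'rV[int]_d.

Definition cylinder : set (set (Zd -> 'I_q.+1)) :=
  [set A | exists S : {fset Zd}, forall omega omega',
     (forall x, x \in S -> omega x = omega' x) -> A omega -> A omega'].

Definition config := g_sigma_algebraType cylinder.

Definition weak_limit (R : realType) (mu_ : nat -> set (Zd -> 'I_q.+1) -> R)
    (mu : probability config R) : Prop :=
  forall A, cylinder A -> (mu_ n A)%:E @[n --> \oo] --> mu A.

End WeakLimit.

Definition boxes_increase_to_lattice (d : nat) (a b : nat -> 'rV[int]_d) :=
  [/\ forall n i, a n 0 i <= b n 0 i,
      forall n, (box (a n) (b n) `<=` box (a n.+1) (b n.+1))%fset
    & forall x, exists n, x \in box (a n) (b n)].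

(* Main.v *)
(* Encode the spins as v in {0, 1, -1}, the vacant state as 0 and the boundary
   state s, if occupied, as 1.  The edge interaction is then K v(x) v(y), and the
   single-site weight makes Ginibre's duplicate-variable argument work: for q = 2
   it is even, for q = 1 the spins are nonnegative.  Hence any two polynomials in
   the spins with nonnegative coefficients are positively correlated.

   Passing from a region to the region without a site x conditions on the spin at
   x being s.  For s <> 0 the indicator of this event is such a polynomial,
   (v + v^2) / 2, and for s = 0 it is 1 - v^2.  So the mean of a nonnegative
   polynomial is monotone in the region: nonincreasing for s <> 0, nondecreasing
   for s = 0.  It converges along all increasing regions, and indicators of
   cylinders are differences of such polynomials.  The limits form a content on
   the algebra of cylinders, countably additive by compactness, which extends to
   the limit measure by Caratheodory's theorem. *)

From HB Require Import structures.
Require Import Defs.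
From mathcomp Require Import all_boot all_order all_algebra perm finmap.
From mathcomp Require Import zify ring lra.
From mathcomp Require Import all_classical all_reals all_analysis.
Set Implicit Arguments.
Unset Strict Implicit.
Unset Printing Implicit Defensive.
Import Order.TTheory GRing.Theory Num.Theory numFieldNormedType.Exports.
Local Open Scope classical_set_scope.
Local Open Scope ring_scope.

(** * Ginibre's inequality *)

Section Ginibre.
Variables (R : realType) (S : finType) (v rho : S -> R).
Hypothesis rho_ge0 : forall t, 0 <= rho t.
Hypothesis v_sym : (forall t, 0 <= v t) \/ exists neg : S -> S,
  [/\ involutive neg, forall t, v (neg t) = - v t
    & forall t, rho (neg t) = rho t].

(** For odd [n], exchanging the two copies changes the sign of each term, so the sum vanishes. For
    even [n] and [v] nonnegative, every term is nonnegative. In the symmetric case an even [m] also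
    gives nonnegative terms, while for odd [m] negating both copies at once changes the sign. *)
Lemma ginibre_site m n : 0 <= \sum_(p : S * S)
  rho p.1 * rho p.2 * ((v p.1 + v p.2) ^+ m * (v p.1 - v p.2) ^+ n).
Proof.
pose swap (p : S * S) := (p.2, p.1).
have swapK : involutive swap by case.
case: (boolP (odd n)) => [n1|n0].
  (* Twice the sum is the sum plus its image under the exchange, and these cancel term by term. *)
  rewrite le_eqVlt eq_sym; apply/orP; left; rewrite -[_ == 0](mulrn_eq0 _ 2).
  rewrite mulr2n {1}(reindex_inj (inv_inj swapK)) -big_split/= big1// => p _.
  rewrite -[v p.2 - v p.1]opprB exprNn -signr_odd n1 expr1
    [v p.2 + _]addrC; set a := _ ^+ m; set b := _ ^+ n; ring.
have ev k (x : R) : ~~ odd k -> 0 <= x ^+ k.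
  by move=> k0; exact: exprn_even_ge0.
case: v_sym => [v0|[neg [negK vN rhoN]]].
  apply: sumr_ge0 => p _; rewrite mulr_ge0 ?(mulr_ge0 (rho_ge0 _) (rho_ge0 _))//.
  by rewrite mulr_ge0 ?(ev _ _ n0)// exprn_ge0// addr_ge0.
case: (boolP (odd m)) => [m1|m0]; last first.
  apply: sumr_ge0 => p _; rewrite mulr_ge0 ?(mulr_ge0 (rho_ge0 _) (rho_ge0 _))//.
  by rewrite mulr_ge0 ?ev.
pose negp (p : S * S) := (neg p.1, neg p.2).
have negpK : involutive negp by case=> x y; rewrite /negp /= !negK.
rewrite le_eqVlt eq_sym; apply/orP; left; rewrite -[_ == 0](mulrn_eq0 _ 2).
rewrite mulr2n {1}(reindex_inj (inv_inj negpK)) -big_split/= big1// => p _.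
rewrite !vN !rhoN -opprD -opprD (exprNn (v _ + v _)) (exprNn (v _ - v _)).
rewrite -(signr_odd _ m) -(signr_odd _ n) m1 (negbTE n0) expr1 expr0.
set a := _ ^+ m; set b := _ ^+ n; ring.
Qed.

(** * Positive multipliers and correlation inequalities on a finite set of sites *)

Variable W : finType.
Implicit Types (F G : {ffun W -> S * S} -> R) (f g : {ffun W -> S} -> R).
Notation lft tau := [ffun x => ((tau : {ffun W -> S * S}) x).1].
Notation rgt tau := [ffun x => ((tau : {ffun W -> S * S}) x).2].

(** Left unnormalised and without interaction: only signs matter, and the interaction enters later
    as a multiplier. *)
Definition duplicate_mean F : R :=
  \sum_(tau : {ffun W -> S * S}) (\prod_x (rho (tau x).1 * rho (tau x).2)) * F tau.

Definition ginibre_monomial (m n : W -> nat) (tau : {ffun W -> S * S}) : R :=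
  \prod_x ((v (tau x).1 + v (tau x).2) ^+ m x * (v (tau x).1 - v (tau x).2) ^+ n x).

Definition positive_pairing F :=
  forall m n, 0 <= duplicate_mean (fun tau => ginibre_monomial m n tau * F tau).

(* Unlike positive pairings, their multipliers are obviously stable under
   products. *)
Definition positive_multiplier F :=
  forall G, positive_pairing G -> positive_pairing (fun tau => F tau * G tau).

(** Without interaction the sum factorises over the sites, and each factor is covered by
    [ginibre_site]. *)
Lemma positive_pairing1 : positive_pairing (fun=> 1).
Proof.
move=> m n; rewrite /duplicate_mean.
under eq_bigr do rewrite mulr1 -big_split/=.
pose H (x : W) (p : S * S) := rho p.1 * rho p.2 *
  ((v p.1 + v p.2) ^+ m x * (v p.1 - v p.2) ^+ n x).
rewrite -(bigA_distr_bigA H).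
by apply: prodr_ge0 => x _; exact: ginibre_site.
Qed.

Lemma duplicate_meanD F G :
  duplicate_mean (fun tau => F tau + G tau) = duplicate_mean F + duplicate_mean G.
Proof. by rewrite -big_split; apply: eq_bigr => tau _; rewrite mulrDr. Qed.

Lemma duplicate_meanZ c F :
  duplicate_mean (fun tau => c * F tau) = c * duplicate_mean F.
Proof. by rewrite big_distrr; apply: eq_bigr => tau _; rewrite mulrCA. Qed.

Lemma positive_multiplierM F G : positive_multiplier F -> positive_multiplier G ->
  positive_multiplier (fun tau => F tau * G tau).
Proof.
move=> pF pG H /pG/pF pH m n; have := pH m n.
by congr (0 <= _); apply: eq_bigr => tau _; rewrite !mulrA.
Qed.

Lemma positive_multiplierD F G : positive_multiplier F -> positive_multiplier G ->
  positive_multiplier (fun tau => F tau + G tau).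
Proof.
move=> pF pG H pH m n; have := addr_ge0 (pF H pH m n) (pG H pH m n).
rewrite -duplicate_meanD.
by congr (0 <= _); apply: eq_bigr => tau _; rewrite mulrDl mulrDr.
Qed.

Lemma positive_multiplierC c : 0 <= c -> positive_multiplier (fun=> c).
Proof.
move=> c0 H pH m n; have := mulr_ge0 c0 (pH m n).
rewrite -duplicate_meanZ.
by congr (0 <= _); apply: eq_bigr => tau _; rewrite [X in _ = _ * X]mulrCA.
Qed.

(** The factor is absorbed by the monomial, whose exponent [m] goes up by one at [x]. *)
Lemma positive_multiplier_add x :
  positive_multiplier (fun tau => v (tau x).1 + v (tau x).2).
Proof.
move=> H pH m n; have := pH (fun y => (y == x) + m y)%N n.
congr (0 <= _); apply: eq_bigr => tau _; congr (_ * _); rewrite mulrA; congr (_ * _).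
rewrite /ginibre_monomial [LHS](bigD1 x)//= [in RHS](bigD1 x)//= eqxx exprS.
under eq_bigr => y /negbTE -> do rewrite add0n.
ring.
Qed.

Lemma positive_multiplier_sub x :
  positive_multiplier (fun tau => v (tau x).1 - v (tau x).2).
Proof.
move=> H pH m n; have := pH m (fun y => (y == x) + n y)%N.
congr (0 <= _); apply: eq_bigr => tau _; congr (_ * _); rewrite mulrA; congr (_ * _).
rewrite /ginibre_monomial [LHS](bigD1 x)//= [in RHS](bigD1 x)//= eqxx exprS.
under eq_bigr => y /negbTE -> do rewrite add0n.
ring.
Qed.

(** The partial sums of the exponential series are multipliers by closure under sums, products and
    nonnegative constants. The duplicate mean is a finite sum, so nonnegativity passes to the
    limit. *)
Lemma positive_multiplier_expR F :
  positive_multiplier F -> positive_multiplier (fun tau => expR (F tau)).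
Proof.
move=> pF H pH m n.
pose T (k : nat) (tau : {ffun W -> S * S}) := series (exp_coeff (F tau)) k.
have pT k : positive_multiplier (T k).
  elim: k => [|k IH].
    rewrite (_ : T 0%N = fun=> 0); first exact: positive_multiplierC.
    by apply/funext => tau; rewrite /T seriesEnat/= big_geq.
  rewrite (_ : T k.+1 = fun tau => T k tau + (F tau) ^+ k * (k`!%:R)^-1).
    apply: positive_multiplierD => //; apply: positive_multiplierM; last first.
      by apply: positive_multiplierC; rewrite invr_ge0.
    elim: k {IH} => [|k IH]; first exact: positive_multiplierC.
    under eq_fun do rewrite exprS.
    exact: positive_multiplierM.
  by apply/funext => tau; rewrite /T !seriesEnat/= big_nat_recr.
have : duplicate_mean (fun tau => ginibre_monomial m n tau * (T k tau * H tau))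
    @[k --> \oo] --> duplicate_mean (fun tau =>
    ginibre_monomial m n tau * (expR (F tau) * H tau)).
  apply: cvg_big => [|tau _]; first exact: add_continuous.
  apply: cvgMl_tmp; apply: cvgMl_tmp; apply: cvgMr_tmp.
  exact: is_cvg_series_exp_coeff.
move=> cT; rewrite -(cvg_lim _ cT)//; apply: limr_ge.
  by apply/cvg_ex; eexists; exact: cT.
by apply: nearW => k; exact: pT.
Qed.

(** The correlation inequality needs the difference for observables and the sum for the energy;
    having both makes the class stable under products. *)
Definition ferromagnetic f :=
  positive_multiplier (fun tau => f (lft tau) + f (rgt tau)) /\
  positive_multiplier (fun tau => f (lft tau) - f (rgt tau)).

Lemma ferromagneticC c : 0 <= c -> ferromagnetic (fun=> c).
Proof.
by move=> c0; split; apply: positive_multiplierC; rewrite ?subrr ?addr_ge0.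
Qed.

Lemma ferromagneticD f g : ferromagnetic f -> ferromagnetic g ->
  ferromagnetic (fun sigma => f sigma + g sigma).
Proof.
move=> [f1 f2] [g1 g2]; split.
  under eq_fun do rewrite addrACA.
  exact: positive_multiplierD.
under eq_fun do rewrite opprD addrACA.
exact: positive_multiplierD.
Qed.

(** With primes for the second copy, twice [f g + f' g'] is [(f + f') (g + g') + (f - f') (g - g')],
    and twice [f g - f' g'] is [(f + f') (g - g') + (f - f') (g + g')]. *)
Lemma ferromagneticM f g : ferromagnetic f -> ferromagnetic g ->
  ferromagnetic (fun sigma => f sigma * g sigma).
Proof.
move=> [f1 f2] [g1 g2]; have h : 0 <= 2^-1 :> R by rewrite invr_ge0.
split.
  rewrite (_ : (fun _ => _) = fun tau => 2^-1 *
      ((f (lft tau) + f (rgt tau)) * (g (lft tau) + g (rgt tau)) +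
       (f (lft tau) - f (rgt tau)) * (g (lft tau) - g (rgt tau)))).
    apply: positive_multiplierM; first exact: positive_multiplierC.
    by apply: positive_multiplierD; exact: positive_multiplierM.
  by apply/funext => tau; field.
rewrite (_ : (fun _ => _) = fun tau => 2^-1 *
    ((f (lft tau) + f (rgt tau)) * (g (lft tau) - g (rgt tau)) +
     (f (lft tau) - f (rgt tau)) * (g (lft tau) + g (rgt tau)))).
  apply: positive_multiplierM; first exact: positive_multiplierC.
  by apply: positive_multiplierD; exact: positive_multiplierM.
by apply/funext => tau; field.
Qed.

Lemma ferromagnetic_spin x : ferromagnetic (fun sigma => v (sigma x)).
Proof.
split.
  under eq_fun do rewrite !ffunE.
  exact: positive_multiplier_add.
under eq_fun do rewrite !ffunE.
exact: positive_multiplier_sub.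
Qed.

Lemma sum_duplicate (H : {ffun W -> S} -> {ffun W -> S} -> R) :
  \sum_(tau : {ffun W -> S * S}) H (lft tau) (rgt tau) =
  \sum_sigma \sum_sigma' H sigma sigma'.
Proof.
rewrite pair_big/= [RHS](reindex (fun tau => (lft tau, rgt tau)))//=.
exists (fun p : {ffun W -> S} * {ffun W -> S} => [ffun x => (p.1 x, p.2 x)]).
  by move=> tau _; apply/ffunP => x; rewrite !ffunE; case: (tau x).
by case=> f g _; congr pair; apply/ffunP => x; rewrite !ffunE.
Qed.

Definition gibbs_weight (H : {ffun W -> S} -> R) (sigma : {ffun W -> S}) : R :=
  (\prod_x rho (sigma x)) * expR (H sigma).

(* Expanding the square of the doubled system, the inequality says that
   (f - f') (g - g') has nonnegative mean, where primes denote the copy. *)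
Lemma griffiths_inequality (H f g : {ffun W -> S} -> R) :
  ferromagnetic H -> ferromagnetic f -> ferromagnetic g ->
  (\sum_sigma gibbs_weight H sigma * f sigma) *
  (\sum_sigma gibbs_weight H sigma * g sigma) <=
  (\sum_sigma gibbs_weight H sigma * (f sigma * g sigma)) *
  (\sum_sigma gibbs_weight H sigma).
Proof.
move=> [H1 _] [_ f2] [_ g2]; set w := gibbs_weight H.
have pos : positive_multiplier (fun tau => expR (H (lft tau) + H (rgt tau)) *
    ((f (lft tau) - f (rgt tau)) * (g (lft tau) - g (rgt tau)))).
  apply: positive_multiplierM; first exact: positive_multiplier_expR.
  exact: positive_multiplierM.
(* With all exponents zero the monomial is 1, which leaves the bare doubled sum. *)
have := pos _ positive_pairing1 (fun=> 0%N) (fun=> 0%N).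
rewrite /duplicate_mean (eq_bigr (fun tau => w (lft tau) * w (rgt tau) *
    ((f (lft tau) - f (rgt tau)) * (g (lft tau) - g (rgt tau))))); last first.
  move=> tau _; rewrite /ginibre_monomial [X in _ * (X * _)]big1; last first.
    by move=> x _; rewrite !expr0 mulr1.
  rewrite mul1r mulr1 mulrA; congr (_ * _).
  rewrite /w /gibbs_weight expRD big_split/=.
  under [in RHS]eq_bigr do rewrite ffunE.
  under [X in _ = _ * (X * _)]eq_bigr do rewrite ffunE.
  ring.
rewrite (sum_duplicate (fun sigma sigma' =>
  w sigma * w sigma' * ((f sigma - f sigma') * (g sigma - g sigma')))).
pose A := \sum_sigma w sigma * (f sigma * g sigma).
pose B := \sum_sigma w sigma * f sigma.
pose C := \sum_sigma w sigma * g sigma.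
pose Z := \sum_sigma w sigma.
rewrite -/A -/B -/C -/Z.
suff -> : \sum_sigma \sum_sigma' (w sigma * w sigma' *
    ((f sigma - f sigma') * (g sigma - g sigma'))) = 2 * (A * Z - B * C).
  by rewrite pmulr_rge0// subr_ge0.
transitivity (\sum_sigma (w sigma * (f sigma * g sigma) * Z + w sigma * A
    - w sigma * f sigma * C - w sigma * g sigma * B)).
  apply: eq_bigr => s _; rewrite /Z /A /B /C !mulr_sumr -big_split/= -!sumrB.
  by apply: eq_bigr => s' _; ring.
by rewrite !sumrB big_split/= -!mulr_suml -/A -/B -/C -/Z; ring.
Qed.

End Ginibre.

(** * Box measures as ratios of sums over configurations *)

Section EdgeWeight.
Variables (R : realType) (q : nat) (K Delta : R) (v : 'I_q.+1 -> R).
Hypothesis v0 : v ord0 = 0.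
Hypothesis v_mul : forall t t', t != ord0 -> t' != ord0 ->
  v t * v t' = 2 * (t == t')%:R - 1.
Variables (W : finType) (F : {set {set W}}).
Hypothesis F2 : forall e, e \in F -> #|e| = 2.
Implicit Types (sigma : {ffun W -> 'I_q.+1}).

(** An edge can be read as an ordered pair in two ways, and symmetry of [P] makes the choice
    immaterial. *)
Lemma exists_pair (P : rel W) (x y : W) : x != y -> symmetric P ->
  [exists x', exists y', ([set x; y]%SET == [set x'; y']%SET) && P x' y'] = P x y.
Proof.
move=> xy symP; apply/existsP/idP => [[x' /existsP[y' /andP[/eqP E Pxy]]]|Pxy].
  have : x \in [set x'; y']%SET by rewrite -E !inE eqxx.
  have : y \in [set x'; y']%SET by rewrite -E !inE eqxx orbT.
  rewrite !inE => /orP[] /eqP yE /orP[] /eqP xE; move: xy Pxy.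
  - by rewrite xE yE eqxx.
  - by rewrite -xE -yE symP.
  - by rewrite -xE -yE.
  - by rewrite xE yE eqxx.
by exists x; apply/existsP; exists y; rewrite eqxx.
Qed.

(** An edge with both ends occupied contributes [- K + 2 K delta], which is [K] times the product of
    its spins by [v_mul]. An edge with a vacant end contributes 0 on both sides. *)
Lemma bcp_weightE sigma : bcp_weight K Delta F sigma =
  expR (K * (\sum_(e in F) \prod_(x in e) v (sigma x)) +
        Delta * \sum_x (sigma x == ord0)%:R).
Proof.
rewrite /bcp_weight; congr (expR (_ + _)).
have -> : #|occupied_edges F sigma|%:R =
    \sum_(e in F) (e \in occupied_edges F sigma)%:R :> R.
  rewrite -sum1_card natr_sum [LHS]big_mkcond [RHS]big_mkcond.
  by apply: eq_bigr => e _; rewrite inE; case: (e \in F); case: [exists _, _].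
rewrite !mulr_sumr -big_split/=.
apply: eq_bigr => e eF; rewrite inE eF/=.
have /eqP/cards2P[x [y [xy ->]]] := F2 eF.
rewrite /edge_delta (exists_pair
  (P := fun x y => (sigma x != ord0) && (sigma y != ord0)))//; last first.
  by move=> ? ?; rewrite andbC.
rewrite (exists_pair
  (P := fun x y => (sigma x == sigma y) && (sigma x != ord0)))//; last first.
  by move=> a b; rewrite eq_sym; case: eqP => // ->.
rewrite big_setU1 ?inE//= big_set1.
have [->|x0] := eqVneq (sigma x) ord0; first by rewrite v0 andbF/=; ring.
have [->|y0] := eqVneq (sigma y) ord0; first by rewrite v0 (negbTE x0) /=; ring.
by rewrite v_mul//=; case: (sigma x == sigma y) => /=; ring.
Qed.

End EdgeWeight.

(** * Lattice edges as finite sets, and their finite-type encoding *)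

Section LatticeEdges.
Variable d : nat.
Notation Zd := 'rV[int]_d.
Implicit Types (V W e : {fset Zd}).

Lemma lattice_edgeP e : lattice_edge e -> exists x y, x != y /\ e = [fset x; y]%fset.
Proof.
move=> [x [y [-> xy]]]; exists x, y; split=> //; apply: contra_eq_neq xy => ->.
by rewrite big1// => i _; rewrite subrr normr0.
Qed.

Lemma region_closureP V x :
  reflect (exists2 e, region_edge V e & x \in e) (x \in region_closure V).
Proof.
rewrite /region_closure in_fset_set; last exact: finite_region_closure.
by apply: (iffP (asboolP _)).
Qed.

Lemma region_edge_closure V e : region_edge V e -> (e `<=` region_closure V)%fset.
Proof. by move=> Ve; apply/fsubsetP => x xe; apply/region_closureP; exists e. Qed.

Lemma finite_region_edge V : finite_set (region_edge V).
Proof.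
apply: (@sub_finite_set _ _ [set` fpowerset (region_closure V)]) => //.
by move=> e /= /region_edge_closure; rewrite fpowersetE.
Qed.

(* [i0] only witnesses [0 < d]: for [d = 0] there are no edges. *)
Lemma sub_region_closure V (i0 : 'I_d) : (V `<=` region_closure V)%fset.
Proof.
apply/fsubsetP => x xV; apply/region_closureP.
pose y : 'rV[int]_d := x + delta_mx 0 i0.
exists [fset x; y]%fset; last by rewrite !inE eqxx.
split; last by exists x => //; rewrite !inE eqxx.
exists x, y; split=> //; rewrite (bigD1 i0)//= big1 ?addr0.
  by rewrite !mxE !eqxx opprD addNKr normrN normr1.
by move=> i /negbTE i0i; rewrite !mxE i0i andbF addr0 subrr normr0.
Qed.

Definition edge_support V : {fset {fset Zd}} := fset_set (region_edge V).

Lemma edge_supportP V e : reflect (region_edge V e) (e \in edge_support V).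
Proof.
rewrite /edge_support in_fset_set ?inE; first exact: asboolP.
exact: finite_region_edge.
Qed.

Section EdgesOn.
Variables (W : {fset Zd}) (E : set {fset Zd}).
Let emb (e : {set W}) : {fset Zd} := [fset val x | x in e]%fset.

Lemma emb_inj : injective emb.
Proof.
move=> e e' ee'; apply/setP => x; apply/idP/idP => xe.
  have : val x \in emb e' by rewrite -ee'; apply/imfsetP; exists x.
  by case/imfsetP => y /= ye' /val_inj ->.
have : val x \in emb e by rewrite ee'; apply/imfsetP; exists x.
by case/imfsetP => y /= ye' /val_inj ->.
Qed.

Lemma big_emb (R : Type) (idx : R) (op : Monoid.com_law idx) (e : {set W})
    (G : Zd -> R) :
  \big[op/idx]_(x <- emb e) G x = \big[op/idx]_(x in e) G (val x).
Proof.
rewrite big_imfset/=; first by rewrite big_enum.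
by move=> x y _ _; exact: val_inj.
Qed.

Lemma card_emb (e : {set W}) : #|` emb e| = #|e|.
Proof.
rewrite card_imfset/=; last exact: val_inj.
by rewrite -cardE.
Qed.

Lemma in_edges_on (e : {set W}) : reflect (E (emb e)) (e \in edges_on W E).
Proof. by rewrite /edges_on finset.in_set; exact: asboolP. Qed.

Hypothesis finE : finite_set E.

(** The finite type [W] sees only the edges contained in it; when [W] is the box itself, this filter
    is the free boundary condition. *)
Lemma sum_edges_on (R : nmodType) (G : {fset Zd} -> R) :
  \sum_(e in edges_on W E) G (emb e) =
  \sum_(e <- fset_set E | (e `<=` W)%fset) G e.
Proof.
rewrite -big_enum/= -(big_map emb xpredT G) -[RHS]big_filter; apply: perm_big.
apply: uniq_perm.
- by rewrite (map_inj_uniq emb_inj) enum_uniq.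
- by rewrite filter_uniq// fset_uniq.
- move=> e; rewrite mem_filter in_fset_set//; apply/mapP/andP.
  move=> [e']; rewrite mem_enum => /in_edges_on Ee ->; split; last by apply: mem_set.
  by apply/fsubsetP => x /imfsetP[y _ ->]; exact: valP.
move=> [/fsubsetP eW /set_mem Ee]; exists [set x | val x \in e]%SET; last first.
  apply/fsetP => x; apply/idP/imfsetP => [xe|[y /= + ->]]; last by rewrite inE.
  by exists [` eW x xe]%fset; rewrite //= inE.
rewrite mem_enum; apply/in_edges_on.
suff -> : emb [set x : W | val x \in e]%SET = e by [].
apply/fsetP => x; apply/imfsetP/idP => [[y /= + ->]|xe]; first by rewrite inE.
by exists [` eW x xe]%fset; rewrite //= inE.
Qed.

End EdgesOn.

End LatticeEdges.

(** * Extension of configurations by the boundary state *)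

Section Extension.
Variables (d q : nat) (s : 'I_q.+1).
Notation Zd := 'rV[int]_d.
Notation S := 'I_q.+1.
Implicit Types (V W : {fset Zd}) (omega : Zd -> S).

Definition restrict_config W omega : {ffun W -> S} := [ffun x => omega (val x)].

Lemma extend_config_out V (eta : {ffun V -> S}) x :
  x \notin V -> extend_config s eta x = s.
Proof. by move=> xV; rewrite /extend_config insubN. Qed.

Lemma extend_config_val V (eta : {ffun V -> S}) (x : V) :
  extend_config s eta (val x) = eta x.
Proof. by rewrite /extend_config valK. Qed.

Lemma extend_config_agree V W omega : (V `<=` W)%fset ->
  (forall x, x \notin V -> omega x = s) ->
  extend_config s (restrict_config W omega) = omega.
Proof.
move=> /fsubsetP VW out; apply/funext => x.
have [xW|xW] := boolP (x \in W).
  by rewrite -[x]/(val [` xW]%fset) extend_config_val ffunE.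
by rewrite extend_config_out ?out//; apply: contra xW; exact: VW.
Qed.

Lemma restrict_extend_config V (eta : {ffun V -> S}) :
  restrict_config V (extend_config s eta) = eta.
Proof. by apply/ffunP => x; rewrite ffunE extend_config_val. Qed.

(** Restriction and extension by [s] are inverse bijections between configurations on [V] and those
    on [W] that equal [s] off [V]. *)
Lemma sum_extend_config (R : nmodType) V W (F : (Zd -> S) -> R) :
  (V `<=` W)%fset ->
  \sum_(sigma : {ffun W -> S} | [forall x, (val x \notin V) ==> (sigma x == s)])
    F (extend_config s sigma) =
  \sum_(eta : {ffun V -> S}) F (extend_config s eta).
Proof.
move=> VW.
rewrite (reindex_onto
  (fun eta : {ffun V -> S} => restrict_config W (extend_config s eta))
  (fun sigma => restrict_config V (extend_config s sigma)))/=.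
  have EE (eta : {ffun V -> S}) :
      extend_config s (restrict_config W (extend_config s eta)) =
      extend_config s eta.
    by apply: extend_config_agree VW _ => x; exact: extend_config_out.
  apply: eq_big => [eta|eta _]; last by rewrite EE.
  rewrite EE restrict_extend_config eqxx andbT.
  by apply/forallP => x; apply/implyP => xV; rewrite ffunE extend_config_out.
move=> sigma /forallP sigmas; rewrite (extend_config_agree (fsubset_refl V)).
  exact: restrict_extend_config.
move=> x xV; have [xW|xW] := boolP (x \in W); last exact: extend_config_out.
have /implyP/(_ xV)/eqP := sigmas [` xW]%fset.
by rewrite -extend_config_val.
Qed.

End Extension.

(** * A common formula for free and occupied boundary conditions *)

Section RegionWeight.
Variables (R : realType) (d q : nat) (K Delta : R) (s : 'I_q.+1).
Variable v : 'I_q.+1 -> R.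
Hypothesis v0 : v ord0 = 0.
Hypothesis v_mul : forall t t', t != ord0 -> t' != ord0 ->
  v t * v t' = 2 * (t == t')%:R - 1.
Hypothesis d_gt0 : (0 < d)%N.
Notation Zd := 'rV[int]_d.
Notation S := 'I_q.+1.
Implicit Types (V W : {fset Zd}) (omega : Zd -> S) (f : (Zd -> S) -> R).

Definition edge_spin omega (e : {fset Zd}) : R := \prod_(x <- e) v (omega x).

(** All edges touching [V] are counted, even for the free boundary condition: there the extension is
    vacant off [V], so [v0] makes the edges leaving [V] contribute 0. *)
Definition region_energy V omega : R :=
  K * \sum_(e <- edge_support V) edge_spin omega e.

Definition region_weight V omega : R :=
  expR (region_energy V omega + Delta * \sum_(x <- V) (omega x == ord0)%:R).

Definition region_sum V f : R :=
  \sum_(eta : {ffun V -> S})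
    region_weight V (extend_config s eta) * f (extend_config s eta).

Lemma region_weight_gt0 V omega : 0 < region_weight V omega.
Proof. exact: expR_gt0. Qed.

Lemma region_sum1_gt0 V : 0 < region_sum V (fun=> 1).
Proof.
rewrite /region_sum (bigD1 [ffun=> s])//= ltr_pwDl ?mulr1 ?region_weight_gt0//.
by apply: sumr_ge0 => eta _; rewrite mulr1 ltW ?region_weight_gt0.
Qed.

(** Serves both [W = V] with [s] vacant and [W = region_closure V] with [s] occupied. The second
    hypothesis disposes of edges sticking out of [W]; the third keeps boundary sites out of the
    [Delta] term. *)
Lemma bcp_weight_region W V (sigma : {ffun W -> S}) :
  (V `<=` W)%fset ->
  (forall e, region_edge V e -> ~~ (e `<=` W)%fset ->
     edge_spin (extend_config s sigma) e = 0) ->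
  (forall x : W, val x \notin V -> sigma x != ord0) ->
  bcp_weight K Delta (edges_on W (region_edge V)) sigma =
  region_weight V (extend_config s sigma).
Proof.
move=> VW cut out; rewrite (bcp_weightE _ _ v0 v_mul); last first.
  move=> e /in_edges_on[/lattice_edgeP[x [y [xy exy]]] _].
  by rewrite -card_emb exy cardfs2 xy.
rewrite /region_weight /region_energy; congr (expR (_ * _ + _ * _)).
  rewrite (eq_bigr (fun e : {set W} => edge_spin (extend_config s sigma)
      [fset val x | x in e]%fset)); last first.
    move=> e _; rewrite /edge_spin big_emb.
    by apply: eq_bigr => x _; rewrite extend_config_val.
  rewrite sum_edges_on; last exact: finite_region_edge.
  rewrite big_seq_cond [RHS]big_seq_cond.
  rewrite [RHS](bigID (fun e => e `<=` W)%fset)/=.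
  rewrite [X in _ = _ + X]big1 ?addr0.
    by apply: eq_bigl => e; rewrite andbT.
  by move=> e /andP[/andP[/edge_supportP Ve _] eW]; exact: cut.
rewrite (eq_bigr (fun x : W => (extend_config s sigma (val x) == ord0)%:R)).
  rewrite -(big_seq_fsetE _ W xpredT
    (fun x => (extend_config s sigma x == ord0)%:R)).
  apply/esym/big_fset_incl => // x xW xV; have /negbTE := out [` xW]%fset xV.
  by rewrite -(extend_config_val s) => ->.
by move=> x _; rewrite extend_config_val.
Qed.

Lemma bcp_weight_box0 V (eta : {ffun V -> S}) : s = ord0 ->
  bcp_weight K Delta (edges_on V (region_edge V)) eta =
  region_weight V (extend_config s eta).
Proof.
move=> s0; apply: bcp_weight_region => //; last by move=> x; rewrite (valP x).
move=> e _ /fsubsetPn[x xe xV].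
by rewrite /edge_spin (big_fsetD1 x)//= extend_config_out// s0 v0 mul0r.
Qed.

(** For occupied [s], the conditional probability is a quotient of two sums over the closure in
    which the total mass cancels. The numerator has a single configuration, and the denominator
    reduces to a sum over [V]. *)
Lemma bcp_regionE V (eta : {ffun V -> S}) :
  bcp_region K Delta s eta =
  region_weight V (extend_config s eta) / region_sum V (fun=> 1).
Proof.
rewrite /bcp_region /region_sum; case: eqVneq => [s0|s0].
  rewrite /bcp_prob big_set1 bcp_weight_box0//; congr (_ / _).
  by apply: eq_bigr => eta' _; rewrite mulr1 bcp_weight_box0.
set W := region_closure V.
have VW : (V `<=` W)%fset := sub_region_closure V (Ordinal d_gt0).
set A := (X in bcp_cond_prob _ _ _ X _); set B := (X in bcp_cond_prob _ _ _ _ X).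
have BP sigma : (sigma \in B) = [forall x : W, (val x \notin V) ==> (sigma x == s)].
  by rewrite /B finset.in_set.
have wB sigma : sigma \in B ->
    bcp_weight K Delta (edges_on W (region_edge V)) sigma =
    region_weight V (extend_config s sigma).
  rewrite BP => /forallP sB; apply: bcp_weight_region => //.
    by move=> e /region_edge_closure ->.
  by move=> x xV; have /implyP/(_ xV)/eqP -> := sB x.
have sumB : \sum_(sigma in B) bcp_weight K Delta (edges_on W (region_edge V)) sigma =
    \sum_(eta : {ffun V -> S}) region_weight V (extend_config s eta) * 1.
  rewrite (eq_bigr _ wB) (eq_bigl _ _ BP) sum_extend_config//.
  by apply: eq_bigr => eta' _; rewrite mulr1.
have AB : A :&: B = [set restrict_config W (extend_config s eta)]%SET.
  apply/setP => sigma; rewrite finset.in_setI BP finset.in_set1 finset.in_set.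
  apply/andP/eqP => [[/forallP sA /forallP sB]|->].
    apply/ffunP => x; rewrite ffunE; have [xV|xV] := boolP (val x \in V).
      have /forallP/(_ [` xV]%fset)/implyP/(_ (eqxx _))/eqP -> := sA x.
      by rewrite -(extend_config_val s).
    by rewrite extend_config_out//; have /implyP/(_ xV)/eqP -> := sB x.
  split; apply/forallP => x.
    apply/forallP => y; apply/implyP => /eqP xy.
    by rewrite ffunE xy extend_config_val.
  by apply/implyP => xV; rewrite ffunE extend_config_out.
have rB : restrict_config W (extend_config s eta) \in B.
  have : restrict_config W (extend_config s eta) \in A :&: B.
    by rewrite AB finset.in_set1.
  by rewrite finset.in_setI => /andP[].
rewrite /bcp_cond_prob /bcp_prob AB big_set1 wB// sumB.
rewrite (extend_config_agree VW); last by move=> x; exact: extend_config_out.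
set Z := \sum_sigma _; have Z0 : Z != 0.
  apply: lt0r_neq0; rewrite /Z (bigD1 [ffun=> s])//= ltr_pwDl ?expR_gt0//.
  by apply: sumr_ge0 => sigma _; exact: expR_ge0.
by rewrite invf_div mulrA divfK.
Qed.

End RegionWeight.

(** * Extension of contents on cylinders *)

Section CylinderSets.
Variables (d q : nat).
Implicit Types A B : set ('rV[int]_d -> 'I_q.+1).

Lemma cylinder0 : cylinder (set0 : set ('rV[int]_d -> 'I_q.+1)).
Proof. by exists fset0. Qed.

Lemma cylinderC A : cylinder A -> cylinder (~` A).
Proof.
move=> [S hS]; exists S => o o' e nA Ao'; apply: nA.
by apply: hS Ao' => x xS; rewrite e.
Qed.

Lemma cylinderU A B : cylinder A -> cylinder B -> cylinder (A `|` B).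
Proof.
move=> [S hS] [S' hS']; exists (S `|` S')%fset => o o' e.
by case=> [Ao|Bo]; [left; apply: hS Ao|right; apply: hS' Bo] => x xS;
  rewrite e// inE xS ?orbT.
Qed.

Lemma cylinderD A B : cylinder A -> cylinder B -> cylinder (A `\` B).
Proof.
move=> cA cB; rewrite setDE -[A]setCK -setCU.
by apply/cylinderC/cylinderU => //; exact: cylinderC.
Qed.

Lemma cylinder_bigsetU (F : nat -> set ('rV[int]_d -> 'I_q.+1)) n :
  (forall i, cylinder (F i)) -> cylinder (\big[setU/set0]_(i < n) F i).
Proof.
by move=> cF; elim/big_ind: _ => [|? ?|? _ //];
  [exact: cylinder0|exact: cylinderU].
Qed.

(* A pointwise limit along an ultrafilter of points of the sets exists because
   the spin set is finite, and every cylinder is closed under such limits. *)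
Lemma cylinder_compact (D : nat -> set ('rV[int]_d -> 'I_q.+1)) :
  (forall n, cylinder (D n)) -> nonincreasing_seq D ->
  (forall n, D n !=set0) -> \bigcap_n D n !=set0.
Proof.
move=> cD dD D0; have [w wD] := choice D0.
have [G [GU FG]] := ultraFilterLemma (eventually_filter : ProperFilter \oo).
have spin x : exists t, G [set n | w n x = t].
  apply: contrapT => /forallNP no; apply: (@filter_not_empty _ G).
  have : G [set n | forall t, w n x <> t].
    apply: filter_forall => t.
    by have [Gt|//] := in_ultra_setVsetC [set n | w n x = t] GU; case: (no t).
  by apply: filterS => n /(_ (w n x)).
have [p Gp] := choice spin; exists p => m _; have [S hS] := cD m.
have : G [set n | forall x, x \in S -> w n x = p x].
  have : G (\bigcap_(x in [set` S]) [set n | w n x = p x]).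
    by apply: filter_bigI => x _; exact: Gp.
  by apply: filterS => n /= h x xS; exact: h.
have : G [set n | (m <= n)%N] by apply: FG; exact: nbhs_infty_ge.
move=> Gm GS; have [n [/= mn /hS Dm]] := filter_ex (filterI Gm GS).
by apply: Dm; have /subsetPset := dD _ _ mn; apply.
Qed.

End CylinderSets.

Section CylinderExtension.
Variables (R : realType) (d q : nat).
Variable ell : set ('rV[int]_d -> 'I_q.+1) -> R.
Hypothesis ell_ge0 : forall A, cylinder A -> 0 <= ell A.
Hypothesis ellT : ell setT = 1.
Hypothesis ellU : forall A B, cylinder A -> cylinder B -> A `&` B = set0 ->
  ell (A `|` B) = ell A + ell B.

(** A synonym of the configuration space on which the measurable sets are the cylinders alone,
    whereas [config] carries the generated sigma-algebra. *)
Definition cylinder_algebra : Type := 'rV[int]_d -> 'I_q.+1.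
HB.instance Definition _ := Pointed.on cylinder_algebra.
HB.instance Definition _ := @isAlgebraOfSets.Build default_measure_display
  cylinder_algebra (@cylinder d q) (@cylinder0 d q) (@cylinderU d q)
  (@cylinderC d q).

(** The default 0 makes the content nonnegative on every set, since nothing is known of [ell] off
    the cylinders. *)
Definition cylinder_content (A : set cylinder_algebra) : \bar R :=
  if `[< cylinder A >] then (ell A)%:E else 0%E.

Lemma cylinder_contentE A : cylinder A -> cylinder_content A = (ell A)%:E.
Proof. by move=> cA; rewrite /cylinder_content asboolT. Qed.

Lemma cylinder_content0 : cylinder_content set0 = 0%E.
Proof.
rewrite (cylinder_contentE (@cylinder0 _ _)); congr _%:E.
apply: (@addrI _ (ell set0)); rewrite -ellU ?setU0 ?addr0// ?setI0//;
  exact: cylinder0.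
Qed.

Lemma cylinder_content_ge0 A : (0 <= cylinder_content A)%E.
Proof.
by rewrite /cylinder_content; case: asboolP => // cA; rewrite lee_fin ell_ge0.
Qed.

Lemma cylinder_content_sum (F : nat -> set cylinder_algebra) n :
  (forall i, cylinder (F i)) -> trivIset setT F ->
  cylinder_content (\big[setU/set0]_(i < n) F i) =
  (\sum_(0 <= i < n) cylinder_content (F i))%E.
Proof.
move=> cF tF; elim: n => [|n IH].
  by rewrite big_ord0 big_geq// cylinder_content0.
rewrite big_ord_recr/= big_nat_recr//= -IH.
have cU := cylinder_bigsetU n cF.
rewrite !cylinder_contentE//; last exact: cylinderU.
rewrite ellU ?EFinD// -subset0 => o [].
rewrite -(bigcup_mkord n F) => -[i/= ilt Fi] Fn.
by move: ilt; rewrite (tF i n I I) ?ltnn//; exists o.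
Qed.

(* Only finitely many members of a disjoint family of cylinders whose union is
   a cylinder are nonempty. *)
Lemma cylinder_content_sigma_additive : semi_sigma_additive cylinder_content.
Proof.
move=> F cF tF cU; pose D n := \bigcup_i F i `\` \big[setU/set0]_(i < n) F i.
(* The remainders [D n] are decreasing cylinders. If all were nonempty, compactness would give a
   point of the union lying in no [F i]. *)
have [N DN] : exists N, D N = set0.
  apply: contrapT => /forallNP D0.
  have [|||o Do] := @cylinder_compact d q D.
  - by move=> n; apply: cylinderD => //; exact: cylinder_bigsetU.
  - move=> m n mn; apply/subsetPset => o -[Uo nB]; split=> // h; apply: nB.
    exact: (@subset_bigsetU _ F _ _ mn).
  - by move=> n; apply/set0P/eqP/D0.
  have [[i _ Fi] _] := Do 0%N I; have [_] := Do i.+1 I; apply.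
  by rewrite big_ord_recr; right.
have UE n : (N <= n)%N -> \bigcup_i F i = \big[setU/set0]_(i < n) F i.
  move=> Nn; apply/seteqP; split=> [x Ux|]; last exact: bigsetU_bigcup.
  apply: contrapT => nB; have : D N x.
    by split=> // h; apply: nB; exact: (@subset_bigsetU _ F _ _ Nn).
  by rewrite DN.
apply: cvg_near_cst; near=> n.
by rewrite -cylinder_content_sum// -UE//; near: n; exact: nbhs_infty_ge.
Unshelve. all: by end_near. Qed.

HB.instance Definition _ := isMeasure.Build _ _ R cylinder_content
  cylinder_content0 cylinder_content_ge0 cylinder_content_sigma_additive.

Definition cylinder_extension (A : set (config d q)) : \bar R :=
  measure_extension cylinder_content A.

Lemma cylinder_extensionE A :
  cylinder A -> cylinder_extension A = (ell A)%:E.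
Proof.
by move=> cA; rewrite /cylinder_extension /measure_extension
  measurable_mu_extE//= cylinder_contentE.
Qed.

Lemma cylinder_extensionT : cylinder_extension setT = 1%E.
Proof. by rewrite cylinder_extensionE ?ellT//; exists fset0. Qed.

(** The same function on the sigma-algebra generated by [cylinder_algebra], which is that of
    [config] up to conversion; the measure axioms are carried over from here. *)
Let extension : {measure set (g_sigma_algebraType
    (@measurable default_measure_display cylinder_algebra)) -> \bar R} :=
  measure_extension cylinder_content.

HB.instance Definition _ := isMeasure.Build _ (config d q) R cylinder_extension
  (measure0 extension) (measure_ge0 extension)
  (@measure_semi_sigma_additive _ _ _ extension).
HB.instance Definition _ := Measure_isProbability.Build _ _ _ cylinder_extension
  cylinder_extensionT.

Lemma exists_cylinder_extension : exists mu : probability (config d q) R,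
  forall A, cylinder A -> mu A = (ell A)%:E.
Proof. by exists cylinder_extension; exact: cylinder_extensionE. Qed.

End CylinderExtension.

(** * Monotone convergence along regions *)

Section FsetFilter.
Variables (R : realType) (T : choiceType).

(** Convergence along the directed set of finite sets: one limit then serves all increasing
    sequences of boxes. *)
Definition fset_filter : set_system {fset T} :=
  filter_from setT (fun A => [set B | (A `<=` B)%fset]).

#[local] Instance fset_filter_proper : ProperFilter fset_filter.
Proof.
apply: filter_from_proper; last by move=> A _; exists A => /=.
apply: filter_fromT_filter; first by exists fset0.
by move=> A B; exists (A `|` B)%fset => C /=; rewrite fsubUset => /andP[].
Qed.

Lemma near_fset_filter (A : {fset T}) :
  \forall B \near fset_filter, (A `<=` B)%fset.
Proof. by exists A. Qed.

Lemma nondecreasing_cvg_fset_filter (g : {fset T} -> R) C :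
  (forall A B, (A `<=` B)%fset -> g A <= g B) -> (forall A, g A <= C) ->
  cvg (g @ fset_filter).
Proof.
move=> g_mono gC; apply/cvg_ex; exists (sup (range g)).
have supg : has_sup (range g).
  by split; [exists (g fset0), fset0|exists C => _ [A _ <-]].
apply/cvgrPdist_lt => e e0; have [_ [A _ <-] gA] := sup_adherent e0 supg.
apply: filterS (near_fset_filter A) => B AB.
have gB : g B <= sup (range g) by apply: ub_le_sup; [case: supg|exists B].
rewrite ger0_norm ?subr_ge0// ltrBlDr -ltrBlDl.
exact: lt_le_trans gA (g_mono _ _ AB).
Qed.

(** A finite set is contained in [u n] as soon as [n] exceeds the stages [N x] at which its points
    appear. *)
Lemma cvg_fset_filter (u : nat -> {fset T}) :
  (forall n, (u n `<=` u n.+1)%fset) -> (forall x, exists n, x \in u n) ->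
  u n @[n --> \oo] --> fset_filter.
Proof.
move=> u_incr u_cover.
have u_mono m n : (m <= n)%N -> (u m `<=` u n)%fset.
  move=> /subnK <-; elim: (n - m)%N => // k; move/fsubset_trans; apply.
  by rewrite addSn.
have [N uN] := choice u_cover.
move=> P [A _ AP]; exists (\max_(x <- A) N x)%N => // n /= nA; apply: AP.
apply/fsubsetP => x xA /=; apply: (fsubsetP (u_mono (N x) n _)) => //.
by apply: leq_trans nA; exact: leq_bigmax_seq.
Qed.

End FsetFilter.
#[global] Existing Instance fset_filter_proper.

(** * Correlation inequalities for encoded spins *)

Section SpinSystem.
Variables (R : realType) (d q : nat) (K Delta : R) (s : 'I_q.+1).
Variable v : 'I_q.+1 -> R.
Hypothesis K_ge0 : 0 <= K.
Hypothesis v0 : v ord0 = 0.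
Hypothesis v_inj : injective v.
Hypothesis v_val : forall t, [\/ v t = 0, v t = 1 | v t = -1].
Hypothesis v_sym : (forall t, 0 <= v t) \/
  exists neg : 'I_q.+1 -> 'I_q.+1, [/\ involutive neg,
    forall t, v (neg t) = - v t & forall t, (neg t == ord0) = (t == ord0)].
Hypothesis vs : s = ord0 \/ v s = 1.
Notation Zd := 'rV[int]_d.
Notation S := 'I_q.+1.
Implicit Types (V W : {fset Zd}) (omega : Zd -> S) (f g : (Zd -> S) -> R).
Local Notation edge_spin := (edge_spin v).
Local Notation region_energy := (region_energy K v).
Local Notation region_weight := (region_weight K Delta v).
Local Notation region_sum := (region_sum K Delta s v).

Inductive positive_polynomial : ((Zd -> S) -> R) -> Prop :=
| positive_constant c : 0 <= c -> positive_polynomial (fun=> c)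
| positive_spin x : positive_polynomial (fun omega => v (omega x))
| positive_add f g : positive_polynomial f -> positive_polynomial g ->
    positive_polynomial (fun omega => f omega + g omega)
| positive_mul f g : positive_polynomial f -> positive_polynomial g ->
    positive_polynomial (fun omega => f omega * g omega).

(** The [Delta] term goes into the single-site weight, where its sign is irrelevant: only positivity
    of [rho] and invariance under [neg] matter. *)
Let rho (t : S) : R := expR (Delta * (t == ord0)%:R).

(** A spin off [W] is the constant [v s], which is 0 or 1 by [vs] and so nonnegative. *)
Lemma positive_polynomial_ferromagnetic W f : positive_polynomial f ->
  ferromagnetic v rho (fun sigma : {ffun W -> S} => f (extend_config s sigma)).
Proof.
elim=> [c c0|x|f1 f2 _ h1 _ h2|f1 f2 _ h1 _ h2].
- exact: ferromagneticC.
- have [xW|xW] := boolP (x \in W).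
    rewrite (_ : (fun _ => _) = fun sigma : {ffun W -> S} => v (sigma [` xW]%fset)).
      exact: ferromagnetic_spin.
    by apply/funext => sigma; rewrite -(extend_config_val s).
  rewrite (_ : (fun _ => _) = fun=> v s).
    by apply: ferromagneticC; case: vs => ->; rewrite ?v0.
  by apply/funext => sigma; rewrite extend_config_out.
- exact: ferromagneticD.
- exact: ferromagneticM.
Qed.

Lemma positive_polynomial_sum (I : Type) (r : seq I) (F : I -> (Zd -> S) -> R) :
  (forall i, positive_polynomial (F i)) ->
  positive_polynomial (fun omega => \sum_(i <- r) F i omega).
Proof.
move=> pF; elim: r => [|i r IH].
  under eq_fun do rewrite big_nil.
  exact: positive_constant.
under eq_fun do rewrite big_cons.
exact: positive_add.
Qed.

Lemma positive_polynomial_prod (I : Type) (r : seq I) (F : I -> (Zd -> S) -> R) :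
  (forall i, positive_polynomial (F i)) ->
  positive_polynomial (fun omega => \prod_(i <- r) F i omega).
Proof.
move=> pF; elim: r => [|i r IH].
  under eq_fun do rewrite big_nil.
  exact: positive_constant.
under eq_fun do rewrite big_cons.
exact: positive_mul.
Qed.

Lemma positive_polynomial_energy V : positive_polynomial (region_energy V).
Proof.
apply: positive_mul; first exact: positive_constant.
by apply: positive_polynomial_sum => e; apply: positive_polynomial_prod => x;
  exact: positive_spin.
Qed.

Lemma region_weight_gibbs V (sigma : {ffun V -> S}) :
  region_weight V (extend_config s sigma) =
  gibbs_weight rho (fun sigma => region_energy V (extend_config s sigma)) sigma.
Proof.
rewrite /region_weight /gibbs_weight expRD mulrC; congr (_ * _).
rewrite mulr_sumr expR_sum big_seq_fsetE/=.
by apply: eq_bigr => x _; rewrite extend_config_val.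
Qed.

Lemma region_sum_griffiths V f g :
  positive_polynomial f -> positive_polynomial g ->
  region_sum V f * region_sum V g <=
  region_sum V (fun omega => f omega * g omega) * region_sum V (fun=> 1).
Proof.
move=> pf pg; rewrite /region_sum.
under eq_bigr do rewrite region_weight_gibbs.
under [X in _ * X <= _]eq_bigr do rewrite region_weight_gibbs.
under [X in _ <= X * _]eq_bigr do rewrite region_weight_gibbs.
under [X in _ <= _ * X]eq_bigr do rewrite region_weight_gibbs mulr1.
apply: griffiths_inequality; try exact: positive_polynomial_ferromagnetic.
- by move=> t; exact: expR_ge0.
- case: v_sym => [|[neg [negK vN zN]]]; first by left.
  by right; exists neg; split=> // t; rewrite /rho zN.
- exact/positive_polynomial_ferromagnetic/positive_polynomial_energy.
Qed.

Lemma region_sumD V f g :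
  region_sum V (fun omega => f omega + g omega) = region_sum V f + region_sum V g.
Proof. by rewrite -big_split; apply: eq_bigr => eta _; rewrite mulrDr. Qed.

Lemma region_sumZ V c f :
  region_sum V (fun omega => c * f omega) = c * region_sum V f.
Proof. by rewrite big_distrr; apply: eq_bigr => eta _; rewrite mulrCA. Qed.

Lemma le_region_sum V f g : (forall omega, f omega <= g omega) ->
  region_sum V f <= region_sum V g.
Proof.
move=> fg; apply: ler_sum => eta _; apply: ler_wpM2l => //.
exact/ltW/region_weight_gt0.
Qed.

Lemma spin_indicator0 t : (t == ord0)%:R = 1 - v t ^+ 2.
Proof.
have [->|t0] := eqVneq t ord0; first by rewrite v0 expr0n subr0.
case: (v_val t) => [vt|->|->]; last 2 first.
- by rewrite expr1n subrr.
- by rewrite sqrrN expr1n subrr.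
by move/eqP: t0; case; apply: v_inj; rewrite vt.
Qed.

Lemma spin_indicator1 t u : v u = 1 -> (t == u)%:R = (v t + v t ^+ 2) / 2.
Proof.
move=> vu; have [->|tu] := eqVneq t u; first by rewrite vu /=; field.
case: (v_val t) => [->|vt|->]; [by rewrite /=; field| |by rewrite /=; field].
by move/eqP: tu; case; apply: v_inj; rewrite vt.
Qed.

(** A negative coefficient appears here, so cylinder indicators call for differences of positive
    polynomials. *)
Lemma spin_indicatorN1 t u : v u = -1 -> (t == u)%:R = (v t ^+ 2 - v t) / 2.
Proof.
move=> vu; have [->|tu] := eqVneq t u; first by rewrite vu /=; field.
case: (v_val t) => [->|->|vt]; [by rewrite /=; field|by rewrite /=; field|].
by move/eqP: tu; case; apply: v_inj; rewrite vt.
Qed.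

Lemma spin_product t t' : t != ord0 -> t' != ord0 ->
  v t * v t' = 2 * (t == t')%:R - 1.
Proof.
have nz u : u != ord0 -> v u <> 0.
  by move=> /eqP u0 vu; apply: u0; apply: v_inj; rewrite vu v0.
move=> /nz t0 /nz t'0; rewrite -(inj_eq v_inj).
have n11 : (1 == -1 :> R) = false by apply/eqP => h; lra.
by case: (v_val t) => // ->; case: (v_val t') => // ->;
  rewrite ?eqxx ?n11 1?[-1 == _]eq_sym ?n11 /=; ring.
Qed.

Lemma edge_spin_out V omega e : (forall x, x \notin V -> omega x = s) ->
  lattice_edge e -> ~ region_edge V e -> edge_spin omega e = edge_spin (fun=> s) e.
Proof.
move=> out le nVe; rewrite /edge_spin big_seq [RHS]big_seq.
apply: eq_bigr => x xe; congr v; apply: out.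
by apply/negP => xV; apply: nVe; split=> //; exists x.
Qed.

(* The edges and the site that [V] does not see carry frozen spins. *)
Lemma region_sum_pin V x : x \notin V -> exists2 c, 0 < c & forall f,
  region_sum (x |` V)%fset (fun omega => (omega x == s)%:R * f omega) =
  c * region_sum V f.
Proof.
move=> xV; set V' := (x |` V)%fset.
have VV' : (V `<=` V')%fset by exact: fsubsetUr.
have EE : (edge_support V `<=` edge_support V')%fset.
  apply/fsubsetP => e /edge_supportP[le [y yV ye]]; apply/edge_supportP.
  by split=> //; exists y => //; rewrite !inE yV orbT.
(* [D] holds the edges at [x] that do not touch [V]. The constant is the weight of what is frozen:
   these edges with both ends in state [s], and the vacancy term of [x]. *)
pose D := (edge_support V' `\` edge_support V)%fset.
exists (expR (K * (\sum_(e <- D) edge_spin (fun=> s) e) + Delta * (s == ord0)%:R)).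
  exact: expR_gt0.
move=> f; rewrite /region_sum mulr_sumr.
rewrite -(sum_extend_config s (fun omega =>
  expR (K * (\sum_(e <- D) edge_spin (fun=> s) e) + Delta * (s == ord0)%:R) *
  (region_weight V omega * f omega)) VV').
rewrite [RHS]big_mkcond; apply: eq_bigr => sigma _.
(* The only site of [V'] off [V] is [x], so a configuration that is not an extension from [V] is
   killed by the indicator. *)
case: ifPn => [/forallP sV|]; last first.
  rewrite negb_forall => /existsP[y]; rewrite negb_imply => /andP[yV sy].
  suff /negbTE -> : extend_config s sigma x != s by rewrite mul0r mulr0.
  suff -> : x = val y by rewrite extend_config_val.
  by have := valP y; rewrite !inE (negbTE yV) orbF => /eqP.
have out y : y \notin V -> extend_config s sigma y = s.
  move=> yV; have [yV'|/extend_config_out ->//] := boolP (y \in V').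
  have /implyP/(_ yV)/eqP := sV [` yV']%fset.
  by rewrite -(extend_config_val s).
rewrite (out x xV) eqxx mul1r mulrA; congr (_ * _).
rewrite /region_weight -expRD; congr expR.
rewrite big_fsetU1//= out// /region_energy.
rewrite (big_fsetID _ (mem (edge_support V)) (edge_support V'))/=.
rewrite (_ : [fset e in edge_support V' | e \in edge_support V]%fset =
    edge_support V); last first.
  by apply/fsetP => e; rewrite !inE/=; apply: andb_idl => /(fsubsetP EE).
rewrite (_ : [fset e in edge_support V' | e \notin edge_support V]%fset = D);
  last first.
  by apply/fsetP => e; rewrite !inE/= andbC.
rewrite (_ : \sum_(e <- D) edge_spin (extend_config s sigma) e =
    \sum_(e <- D) edge_spin (fun=> s) e).
  by rewrite !mulrDr [X in X + _ = _]addrC addrACA.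
rewrite big_seq [RHS]big_seq; apply: eq_bigr => e.
rewrite inE => /andP[/edge_supportP nVe /edge_supportP[le _]].
exact: (edge_spin_out out le nVe).
Qed.

(** * Monotonicity and convergence of means *)

Definition region_mean V f : R := region_sum V f / region_sum V (fun=> 1).

(** By [region_sum_pin] the mean on [V] is the mean on the larger region conditioned on the spin [s]
    at [x]. The inequality is the correlation of [f] with that event: negative for vacant [s],
    positive for occupied [s]. *)
Lemma region_mean_step V x f : positive_polynomial f ->
  if s == ord0 then region_mean V f <= region_mean (x |` V)%fset f
  else region_mean (x |` V)%fset f <= region_mean V f.
Proof.
move=> pf; have [xV|xV] := boolP (x \in V).
  rewrite (_ : (x |` V)%fset = V) ?lexx ?if_same//.
  by apply/fsetUidPr; rewrite fsub1set.
have [c c0 pin] := region_sum_pin xV; set V' := (x |` V)%fset in pin *.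
have z0 W : 0 < region_sum W (fun=> 1) by exact: region_sum1_gt0.
have meanE g : region_mean V g =
    region_sum V' (fun omega => (omega x == s)%:R * g omega) /
    region_sum V' (fun omega => (omega x == s)%:R * 1).
  by rewrite !pin -mulf_div divff ?mul1r// gt_eqF.
have p0 : 0 < region_sum V' (fun omega => (omega x == s)%:R * 1).
  by rewrite pin mulr_gt0.
rewrite meanE /region_mean.
case: eqVneq => [s0|s0].
  rewrite ler_pdivrMr// mulrAC ler_pdivlMr//.
  have pv2 : positive_polynomial (fun omega => v (omega x) * v (omega x)).
    by apply: positive_mul; exact: positive_spin.
  have := region_sum_griffiths V' pf pv2.
  have eF g : region_sum V' (fun omega => (omega x == s)%:R * g omega) =
      region_sum V' g -
      region_sum V' (fun omega => g omega * (v (omega x) * v (omega x))).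
    rewrite -mulN1r -region_sumZ -region_sumD; congr region_sum.
    by apply/funext => omega; rewrite s0 spin_indicator0; ring.
  (* The product of the sums of [f] and 1 occurs on both sides; cancelling it leaves the correlation
     inequality of [f] with the squared spin. *)
  rewrite !eF mulrBl mulrBr lerD2l lerN2.
  by congr (_ * _ <= _); congr region_sum; apply/funext => omega; rewrite mul1r.
have vs1 : v s = 1 by case: vs => // h; rewrite h eqxx in s0.
rewrite ler_pdivrMr// mulrAC ler_pdivlMr//.
have pI : positive_polynomial (fun omega => (omega x == s)%:R).
  under eq_fun do rewrite spin_indicator1//.
  apply: positive_mul; last by apply: positive_constant; rewrite invr_ge0.
  under eq_fun do rewrite expr2.
  apply: positive_add; first exact: positive_spin.
  by apply: positive_mul; exact: positive_spin.
have := region_sum_griffiths V' pf pI; congr (_ * _ <= _ * _).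
  by congr region_sum; apply/funext => omega; rewrite mulr1.
by congr region_sum; apply/funext => omega; rewrite mulrC.
Qed.

Lemma region_mean_mono V W f : positive_polynomial f -> (V `<=` W)%fset ->
  if s == ord0 then region_mean V f <= region_mean W f
  else region_mean W f <= region_mean V f.
Proof.
(* With [W] replaced by its union with [V], the induction can run over arbitrary finite sets [W],
   removing one site at a time. *)
move=> pf /fsetUidPr <-.
elim/finSet_rect: W => W IH.
have [->|[x xW]] := fset_0Vmem W; first by rewrite fsetU0 lexx if_same.
have := IH (W `\ x)%fset (fproperD1 xW).
have := region_mean_step (V `|` (W `\ x))%fset x pf.
have -> : (x |` (V `|` (W `\ x)) = V `|` W)%fset.
  by rewrite fsetUCA fsetD1K.
by case: ifP => _ h1 h2; [exact: le_trans h1|exact: le_trans h2].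
Qed.

Lemma positive_polynomial_bounded f : positive_polynomial f ->
  exists C, forall omega, `|f omega| <= C.
Proof.
elim=> [c c0|x|f1 f2 _ [C1 h1] _ [C2 h2]|f1 f2 _ [C1 h1] _ [C2 h2]].
- by exists c => omega; rewrite ger0_norm.
- exists 1 => omega; case: (v_val (omega x)) => ->.
  + by rewrite normr0.
  + by rewrite normr1.
  + by rewrite normrN1.
- by exists (C1 + C2) => omega; rewrite (le_trans (ler_normD _ _))// lerD.
- by exists (C1 * C2) => omega; rewrite normrM ler_pM.
Qed.

Lemma region_meanD V f g :
  region_mean V (fun omega => f omega + g omega) = region_mean V f + region_mean V g.
Proof. by rewrite /region_mean region_sumD mulrDl. Qed.

Lemma region_meanN V f :
  region_mean V (fun omega => - f omega) = - region_mean V f.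
Proof.
rewrite /region_mean -mulNr -mulN1r -region_sumZ.
by congr (region_sum _ _ / _); apply/funext => omega; rewrite mulN1r.
Qed.

Lemma le_region_mean V f g : (forall omega, f omega <= g omega) ->
  region_mean V f <= region_mean V g.
Proof.
by move=> fg; rewrite ler_pM2r ?invr_gt0 ?le_region_sum//; exact: region_sum1_gt0.
Qed.

Lemma region_mean_cst V c : region_mean V (fun=> c) = c.
Proof.
have /lt0r_neq0 z0 := region_sum1_gt0 K Delta s v V.
rewrite /region_mean -[fun=> c](_ : (fun=> c * 1) = _); last first.
  by apply/funext => ?; rewrite mulr1.
by rewrite region_sumZ mulfK.
Qed.

Lemma region_mean_cvg f : positive_polynomial f ->
  cvg (region_mean V f @[V --> @fset_filter Zd]).
Proof.
move=> pf; have [C fC] := positive_polynomial_bounded pf.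
case: (boolP (s == ord0)) => s0.
  apply: (@nondecreasing_cvg_fset_filter _ _ _ C) => [V W VW|V].
    by have := region_mean_mono pf VW; rewrite s0.
  rewrite -[leRHS](region_mean_cst V); apply: le_region_mean => omega.
  exact: le_trans (ler_norm _) (fC omega).
(* For occupied [s] the means decrease, so their opposites form the bounded nondecreasing family. *)
rewrite -is_cvgNE; apply: (@nondecreasing_cvg_fset_filter _ _ _ C) => [V W VW|V] /=.
  by rewrite lerN2; have := region_mean_mono pf VW; rewrite (negbTE s0).
apply: (@le_trans _ _ (region_mean V (fun omega => - f omega))).
  by rewrite region_meanN.
rewrite -[leRHS](region_mean_cst V); apply: le_region_mean => omega.
by apply: le_trans (fC omega); rewrite -normrN ler_norm.
Qed.

(** Monotonicity is lost for such differences, but convergence survives by linearity of the mean. *)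
Definition polynomial f := exists2 g, positive_polynomial g &
  exists2 h, positive_polynomial h & forall omega, f omega = g omega - h omega.

Lemma polynomial_cvg f : polynomial f ->
  cvg (region_mean V f @[V --> @fset_filter Zd]).
Proof.
move=> [g pg [h ph fE]].
rewrite (_ : f = fun omega => g omega + - h omega); last exact/funext.
under eq_is_cvg do rewrite region_meanD region_meanN.
by apply: is_cvgB; exact: region_mean_cvg.
Qed.

Lemma polynomial_positive f : positive_polynomial f -> polynomial f.
Proof.
move=> pf; exists f => //; exists (fun=> 0); first exact: positive_constant.
by move=> omega; rewrite subr0.
Qed.

Lemma polynomialN f : polynomial f -> polynomial (fun omega => - f omega).
Proof.
by move=> [g pg [h ph fE]]; exists h => //; exists g => // omega; rewrite fE opprB.
Qed.

Lemma polynomialD f g : polynomial f -> polynomial g ->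
  polynomial (fun omega => f omega + g omega).
Proof.
move=> [f1 pf1 [f2 pf2 fE]] [g1 pg1 [g2 pg2 gE]].
exists (fun omega => f1 omega + g1 omega); first exact: positive_add.
exists (fun omega => f2 omega + g2 omega); first exact: positive_add.
by move=> omega; rewrite fE gE; ring.
Qed.

Lemma polynomialM f g : polynomial f -> polynomial g ->
  polynomial (fun omega => f omega * g omega).
Proof.
move=> [f1 pf1 [f2 pf2 fE]] [g1 pg1 [g2 pg2 gE]].
exists (fun omega => f1 omega * g1 omega + f2 omega * g2 omega).
  by apply: positive_add; exact: positive_mul.
exists (fun omega => f1 omega * g2 omega + f2 omega * g1 omega).
  by apply: positive_add; exact: positive_mul.
by move=> omega; rewrite fE gE; ring.
Qed.

Lemma polynomial_spin_indicator x u :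
  polynomial (fun omega => (omega x == u)%:R).
Proof.
have pv : polynomial (fun omega => v (omega x)).
  exact/polynomial_positive/positive_spin.
have pv2 : polynomial (fun omega => v (omega x) ^+ 2).
  by under eq_fun do rewrite expr2; exact: polynomialM.
have ph : polynomial (fun=> 2^-1).
  by apply/polynomial_positive/positive_constant; rewrite invr_ge0.
case: (v_val u) => vu.
- rewrite (_ : u = ord0); last by apply: v_inj; rewrite vu v0.
  under eq_fun do rewrite spin_indicator0.
  apply: polynomialD; last exact: polynomialN.
  exact/polynomial_positive/positive_constant.
- under eq_fun do rewrite spin_indicator1//.
  by apply: polynomialM => //; exact: polynomialD.
- under eq_fun do rewrite spin_indicatorN1//.
  by apply: polynomialM => //; apply: polynomialD => //; exact: polynomialN.
Qed.

Lemma polynomial_cst c : polynomial (fun=> c).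
Proof.
have [c0|c0] := lerP 0 c; first exact/polynomial_positive/positive_constant.
rewrite -[c]opprK; apply: polynomialN.
by apply/polynomial_positive/positive_constant; rewrite oppr_ge0 ltW.
Qed.

Lemma polynomial_cylinder (A : set (Zd -> S)) : cylinder A ->
  polynomial (fun omega => `[< A omega >]%:R).
Proof.
move=> [B AB]; have AE omega omega' : (forall x, x \in B -> omega x = omega' x) ->
    `[< A omega >] = `[< A omega' >].
  move=> e; apply/asboolP/asboolP; first exact: AB.
  by apply: AB => x xB; rewrite e.
(* Expansion over the patterns [tau] on the finite base [B]: only the restriction of [omega]
   contributes. The filler [s] off [B] does not affect membership in [A]. *)
rewrite (_ : (fun _ => _) = fun omega => \sum_(tau : {ffun B -> S})
    (`[< A (extend_config s tau) >]%:R *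
     \prod_(x : B) (omega (val x) == tau x)%:R)); last first.
  apply/funext => omega; rewrite (bigD1 (restrict_config B omega))//=.
  rewrite [X in _ * X]big1 ?mulr1; last by move=> x _; rewrite ffunE eqxx.
  rewrite [X in _ + X]big1 ?addr0; last first.
    move=> tau /eqP tauB; have [x xB] : exists x, tau x != omega (val x).
      apply/existsP; apply: contra_notT tauB; rewrite negb_exists => /forallP h.
      by apply/ffunP => x; rewrite ffunE; apply/eqP; rewrite -[_ == _]negbK.
    by rewrite (bigD1 x)//= eq_sym (negbTE xB) mul0r mulr0.
  congr (nat_of_bool _)%:R; apply: AE => x xB.
  by rewrite -[x]/(val [` xB]%fset) extend_config_val ffunE.
rewrite /index_enum; elim: (Finite.enum _) => [|tau r IH].
  under eq_fun do rewrite big_nil.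
  exact: polynomial_cst.
under eq_fun do rewrite big_cons.
apply: polynomialD => //; apply: polynomialM; first exact: polynomial_cst.
rewrite /index_enum; elim: (Finite.enum _) => [|x r' IH'].
  under eq_fun do rewrite big_nil.
  exact: polynomial_cst.
under eq_fun do rewrite big_cons.
by apply: polynomialM => //; exact: polynomial_spin_indicator.
Qed.

(** * The limiting content and the weak limit *)

Definition cylinder_limit (A : set (Zd -> S)) : R :=
  lim (region_mean V (fun omega => `[< A omega >]%:R) @[V --> @fset_filter Zd]).

Lemma cylinder_limitP (A : set (Zd -> S)) : cylinder A ->
  region_mean V (fun omega => `[< A omega >]%:R) @[V --> @fset_filter Zd] -->
  cylinder_limit A.
Proof. by move=> cA; exact/polynomial_cvg/polynomial_cylinder. Qed.

Lemma cylinder_limit_ge0 (A : set (Zd -> S)) : cylinder A -> 0 <= cylinder_limit A.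
Proof.
move=> cA; apply: limr_ge; first exact: cvgP (cylinder_limitP cA).
by apply: nearW => V; rewrite -[leLHS](region_mean_cst V); exact: le_region_mean.
Qed.

Lemma cylinder_limitT : cylinder_limit setT = 1.
Proof.
rewrite /cylinder_limit; apply: cvg_lim => //.
under eq_cvg => V.
  rewrite (_ : (fun _ => _) = fun=> 1); last first.
    by apply/funext => omega; rewrite asboolT.
  rewrite region_mean_cst.
  over.
exact: cvg_cst.
Qed.

Lemma cylinder_limitU (A B : set (Zd -> S)) : cylinder A -> cylinder B ->
  A `&` B = set0 -> cylinder_limit (A `|` B) = cylinder_limit A + cylinder_limit B.
Proof.
move=> cA cB AB; rewrite {1}/cylinder_limit; apply: cvg_lim => //.
under eq_cvg => V.
  rewrite (_ : (fun _ => _) =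
    fun omega => `[< A omega >]%:R + `[< B omega >]%:R); last first.
    apply/funext => omega.
    case: (asboolP (A omega)) => a; case: (asboolP (B omega)) => b.
    - by have : (A `&` B) omega by []; rewrite AB.
    - by rewrite asboolT ?addr0//; left.
    - by rewrite asboolT ?add0r//; right.
    - by rewrite asboolF ?addr0// => -[].
  rewrite region_meanD.
  over.
by apply: cvgD; exact: cylinder_limitP.
Qed.

Hypothesis d_gt0 : (0 < d)%N.

Lemma bcp_boxE (a b : Zd) (A : set (Zd -> S)) :
  bcp_box K Delta s a b A = region_mean (box a b) (fun omega => `[< A omega >]%:R).
Proof.
rewrite /bcp_box /region_mean /region_sum big_mkcond mulr_suml.
apply: eq_bigr => eta _; rewrite (bcp_regionE _ _ _ v0 spin_product d_gt0).
by case: ifP => _; rewrite ?mulr1// mulr0 mul0r.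
Qed.

Lemma exists_weak_limit : exists pi : probability (config d q) R,
  forall a b : nat -> Zd, boxes_increase_to_lattice a b ->
    weak_limit (fun n => bcp_box K Delta s (a n) (b n)) pi.
Proof.
(* The measure is fixed before any sequence of boxes is given, so the limit is the same for all of
   them. *)
have [pi piE] := exists_cylinder_extension
  cylinder_limit_ge0 cylinder_limitT cylinder_limitU.
exists pi => a b [_ incr cover] A cA; rewrite piE//.
apply: cvg_EFin; first exact: nearW.
rewrite (_ : _ \o _ = (fun V => region_mean V (fun omega => `[< A omega >]%:R)) \o
    (fun n => box (a n) (b n))); last by apply/funext => n /=; rewrite bcp_boxE.
apply: cvg_comp (cylinder_limitP cA).
exact: (cvg_fset_filter (u := fun n => box (a n) (b n))).
Qed.

End SpinSystem.

(** * The encoding for one or two occupied states, and the conclusion *)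

Lemma exists_spin_encoding (R : realType) (q : nat) (s : 'I_q.+1) :
  q = 1%N \/ q = 2%N -> exists v : 'I_q.+1 -> R,
  [/\ v ord0 = 0, injective v, forall t, [\/ v t = 0, v t = 1 | v t = -1],
    (forall t, 0 <= v t) \/ exists neg : 'I_q.+1 -> 'I_q.+1, [/\ involutive neg,
      forall t, v (neg t) = - v t & forall t, (neg t == ord0) = (t == ord0)]
    & s = ord0 \/ v s = 1].
Proof.
(* [u] is the state encoded as 1. It must be [s] when [s] is occupied; otherwise any occupied state
   would do. *)
move=> hq; pose u : 'I_q.+1 := if s == ord0 then inord 1 else s.
have u0 : u != ord0.
  rewrite /u; case: ifPn => // _; apply/eqP => /(congr1 val).
  by rewrite /= inordK//; case: hq => ->.
pose v (t : 'I_q.+1) : R := if t == ord0 then 0 else if t == u then 1 else -1.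
have two t t' : t != ord0 -> t' != ord0 -> t != u -> t' != u -> t = t'.
  rewrite -!val_eqE /= in u0 *; move=> t0 t'0 tu t'u; apply: val_inj => /=.
  have q2 : (q <= 2)%N by case: hq => ->.
  by have := ltn_ord u; have := ltn_ord t; have := ltn_ord t'; lia.
have v0 : v ord0 = 0 by rewrite /v eqxx.
have n10 : (-1 == 0 :> R) = false by rewrite oppr_eq0 oner_eq0.
have n11 : (-1 == 1 :> R) = false.
  by apply/eqP => h; have : (-1 : R) < 1 by []; rewrite h ltxx.
have v_inj : injective v.
  move=> t t'; rewrite /v; case: (eqVneq t ord0) => [->|t0];
    case: (eqVneq t' ord0) => [->|t'0] //.
  - by case: ifP => _ /esym/eqP; rewrite ?oner_eq0 ?n10.
  - by case: ifP => _ /eqP; rewrite ?oner_eq0 ?n10.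
  case: (eqVneq t u) => [->|tu]; case: (eqVneq t' u) => [->|t'u] //.
  - by move/esym/eqP; rewrite n11.
  - by move/eqP; rewrite n11.
  by move=> _; exact: two.
exists v; split=> //.
- move=> t; rewrite /v; case: eqP => _; first by constructor 1.
  by case: eqP => _; [constructor 2|constructor 3].
(* A second occupied state [w] exists only for [q = 2]; exchanging it with [u] is then the required
   symmetry. Without it no spin is negative. *)
- case: (pselect (exists w, w != ord0 /\ w != u)) => [[w [w0 wu]]|nw]; last first.
    left=> t; rewrite /v; case: eqVneq => // t0; case: eqVneq => // tu.
    by case: nw; exists t.
  right; exists (tperm u w); split=> [t|t|t]; first exact: tpermK.
    rewrite /v; case: tpermP => [->|->|/eqP tu /eqP tw].
    + by rewrite (negbTE w0) (negbTE wu) (negbTE u0) eqxx.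
    + by rewrite (negbTE u0) eqxx (negbTE w0) (negbTE wu) opprK.
    + have -> : t = ord0.
        by apply/eqP/negPn/negP => t0; rewrite (two t w) ?eqxx in tw.
      by rewrite eqxx oppr0.
  case: tpermP => [->|->|//]; first by rewrite (negbTE w0) (negbTE u0).
  by rewrite (negbTE w0) (negbTE u0).
- have [->|s0] := eqVneq s ord0; [by left|right].
  by rewrite /v (negbTE s0) /u (negbTE s0) eqxx.
Qed.

Theorem theorem7p3 (R : realType) (d q : nat) (K Delta : R) (s : 'I_q.+1)
    (hd : (2 <= d)%N) (hK : 0 <= K) (hq : q = 1%N \/ q = 2%N) :
  exists pi : probability (config d q) R,
    forall a b : nat -> 'rV[int]_d, boxes_increase_to_lattice a b ->
      weak_limit (fun n => bcp_box K Delta s (a n) (b n)) pi.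
Proof.
have [v [v0 v_inj v_val v_sym vs]] := exists_spin_encoding R s hq.
exact: (exists_weak_limit Delta hK v0 v_inj v_val v_sym vs (ltnW hd)).
Qed.
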